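(* Let $X$ be a finite-dimensional real Banach space, let $A\colon X\rightrightarrows X^*$ be maximally monotone and let $x\in\operatorname{dom}A$. Assume that there exist $d\in X$ and $\varepsilon_0>0$ such that $x+\varepsilon_0d\in\operatorname{int}\operatorname{dom}A$. Then $$[Ax]_d:=\big\{x^*\in Ax\mid\langle x^*,d\rangle=\sup\langle Ax,d\rangle\big\}$$ is nonempty and compact. Moreover, if a sequence $(x_n)_{n\in\mathbb N}$ in $\operatorname{dom}A$, with $x_n\neq x$ for all $n$, is such that $x_n\to x$ and $$\lim_{n\to\infty}\frac{x_n-x}{\|x_n-x\|}=d,$$ then for every $\varepsilon>0$ there exists $N\in\mathbb N$ such that $$A(x_n)\subseteq[Ax]_d+\varepsilon B_{X^*}\quad\text{for all }n\ge N.$$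
   Context: $X^*$ is the dual of $X$ with pairing $\langle\cdot,\cdot\rangle$, and $B_{X^*}$ is the closed unit ball of $X^*$. A set-valued operator $A\colon X\rightrightarrows X^*$ assigns to each $x\in X$ a (possibly empty) set $Ax\subseteq X^*$; $\operatorname{gra}A=\{(x,x^* )\mid x^*\in Ax\}$ and $\operatorname{dom}A=\{x\mid Ax\neq\varnothing\}$. $A$ is monotone if $\langle x-y,x^*-y^*\rangle\ge0$ for all $(x,x^* ),(y,y^* )\in\operatorname{gra}A$, and maximally monotone if it is monotone and has no proper monotone extension (in the sense of graph inclusion). Notation: $\sup\langle Ax,d\rangle:=\sup_{x^*\in Ax}\langle x^*,d\rangle$. *)

(* Defs.v *)
From HB Require Import structures.
From mathcomp Require Import all_boot all_order all_algebra.
From mathcomp Require Import all_classical all_reals all_analysis.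

Set Implicit Arguments.
Unset Strict Implicit.
Unset Printing Implicit Defensive.

Import Order.TTheory GRing.Theory Num.Theory.
Import numFieldNormedType.Exports.

Local Open Scope classical_set_scope.
Local Open Scope ring_scope.

Definition finite_dimensional (R : realType) (X : normedModType R) : Prop :=
  exists n : nat, inhabited (Vector.axiom n X).

Definition continuous_linear (R : realType) (X : normedModType R) :
  {pred X -> R^o} := mem [set f : X -> R^o | linear f /\ continuous f].
Arguments continuous_linear {R} X _ : assert.

(* X^*, the space of continuous linear functionals; its topology is that of
   the operator norm, so that compactness of a set of functionals is norm
   compactness. *)
Record dual (R : realType) (X : normedModType R) := Dual {
  dual_fun :> X -> R^o;
  dual_funP : dual_fun \in continuous_linear X }.

Section dual_normedModType.
Variables (R : realType) (X : normedModType R).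
Implicit Types f g : dual X.

HB.instance Definition _ := [isSub for @dual_fun R X].
HB.instance Definition _ := [Choice of dual X by <:].

Fact continuous_linear_submod_closed : submod_closed (continuous_linear X).
Proof.
split=> [|a f g].
  rewrite inE; split=> [b u v|]; last exact: cst_continuous.
  by rewrite /GRing.zero/= scaler0 addr0.
rewrite !inE => -[lf cf] [lg cg]; split=> [b u v|x].
  rewrite !fctE lf lg !scalerDr !scalerA [a * b]mulrC.
  by rewrite addrACA.
apply: (@continuousD R R^o X (a *: f) g); last exact: cg.
by apply: continuousZr; exact: cf.
Qed.

HB.instance Definition _ :=
  GRing.isSubmodClosed.Build R (X -> R^o) (continuous_linear X)
    continuous_linear_submod_closed.
HB.instance Definition _ := [SubChoice_isSubLmodule of dual X by <:].

Lemma dual_linear f : linear f.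
Proof. by have := dual_funP f; rewrite inE => -[]. Qed.

Lemma dual_continuous f : continuous f.
Proof. by have := dual_funP f; rewrite inE => -[]. Qed.

Lemma dualD f g x : (f + g) x = f x + g x.
Proof. by []. Qed.

Lemma dualZ a f x : (a *: f) x = a *: f x.
Proof. by []. Qed.

Lemma dual0 x : (0 : dual X) x = 0.
Proof. by []. Qed.

HB.instance Definition _ f := GRing.isLinear.Build R X R^o _ f (dual_linear f).

Definition dual_norm f : R := sup [set `|f x| | x in [set x | `|x| <= 1]].

Let dual_bounded f : has_sup [set `|f x| | x in [set x | `|x| <= 1]].
Proof.
split; first by exists `|f 0|, 0 => //=; rewrite normr0.
have /linear_boundedP : bounded_near f (nbhs (0 : X)).
  exact/linear_bounded_continuous/dual_continuous.
move=> /pinfty_ex_gt0[M M0 fM]; exists M => _ [x /= x1 <-].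
by rewrite (le_trans (fM x))// ler_piMr// ltW.
Qed.

Let dual_norm_ub f x : `|x| <= 1 -> `|f x| <= dual_norm f.
Proof. by move=> x1; apply: sup_upper_bound => //; exists x. Qed.

Let dual_norm_le f (c : R) :
  (forall x, `|x| <= 1 -> `|f x| <= c) -> dual_norm f <= c.
Proof.
move=> fc; apply: ge_sup; first by case: (dual_bounded f).
by move=> _ [x /= x1 <-]; exact: fc.
Qed.

Let ler_dual_normD f g : dual_norm (f + g) <= dual_norm f + dual_norm g.
Proof.
apply: dual_norm_le => x x1; rewrite dualD (le_trans (ler_normD _ _))//.
by rewrite lerD// dual_norm_ub.
Qed.

Let dual_normZ (a : R) f : dual_norm (a *: f) = `|a| * dual_norm f.
Proof.
have le_Z (b : R) g : dual_norm (b *: g) <= `|b| * dual_norm g.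
  apply: dual_norm_le => x x1.
  by rewrite dualZ normrM ler_wpM2l// dual_norm_ub.
apply/eqP; rewrite eq_le le_Z/=.
have [->|a0] := eqVneq a 0.
  rewrite normr0 mul0r scale0r.
  by rewrite (le_trans (normr_ge0 ((0 : dual X) 0)))// dual_norm_ub// normr0.
rewrite -ler_pdivlMl ?normr_gt0// -normfV.
by rewrite -[X in dual_norm X <= _](scalerK a0).
Qed.

Let dual_norm0_eq0 f : dual_norm f = 0 -> f = 0.
Proof.
move=> f0; apply/val_inj/funext => x /=; rewrite -[RHS]/(0 : R).
have [->|x0] := eqVneq x 0; first exact: linear0.
have := @dual_norm_ub f (`|x|^-1 *: x).
rewrite f0 normrZ normfV normr_id mulVf ?normr_eq0// => /(_ (lexx _)).
rewrite normr_le0 linearZ/= mulf_eq0 invr_eq0 normr_eq0 (negbTE x0)/=.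
by move/eqP.
Qed.

HB.instance Definition _ := Lmodule_isNormed.Build R (dual X)
  ler_dual_normD dual_normZ dual_norm0_eq0.

Lemma dual_normE f : `|f| = dual_norm f.
Proof. by []. Qed.

End dual_normedModType.

Section set_valued_operators.
Variables (R : realType) (X : normedModType R).
Implicit Types A B : X -> set (dual X).

Definition gra A : set (X * dual X) := [set p | A p.1 p.2].

Definition dom A : set X := [set x | A x !=set0].

Definition monotone_operator A : Prop := forall p q, gra A p -> gra A q ->
  0 <= (p.2 - q.2) (p.1 - q.1).

Definition maximally_monotone A : Prop :=
  monotone_operator A /\ forall B, monotone_operator B -> ~ gra A `<` gra B.

(* [Ax]_d; the supremum is taken in the extended reals, so the equation can only
   hold when it is finite. *)
Definition directional_face A (x d : X) : set (dual X) :=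
  [set xs | A x xs /\
            ((xs d : R)%:E = ereal_sup [set (ys d : R)%:E | ys in A x])%E].

Definition dual_ball : set (dual X) := [set xs | `|xs| <= 1].

End set_valued_operators.
Arguments dual_ball {R} X.

(* Main.v *)
From HB Require Import structures.
Require Import Defs.
From mathcomp Require Import all_boot all_order all_algebra.
From mathcomp Require Import all_classical all_reals all_analysis.
From mathcomp Require Import lra.
Import Order.TTheory GRing.Theory Num.Theory.
Import numFieldNormedType.Exports.
Local Open Scope classical_set_scope.
Local Open Scope ring_scope.
Set Implicit Arguments.
Unset Strict Implicit.
Unset Printing Implicit Defensive.

(** Everything rests on one a priori bound.  Let [z] be interior to [dom A], and
    let [f] be in [A y].  For each small [u] choose [G u] in [A (z + u)];
    monotonicity gives [f (z + u - y) <= G u (z + u - y)].  If [z - y] is close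
    to a vector [p] on which [f] is bounded below, this bounds [f u] above, up
    to a small multiple of the norm of [f].  In finite dimension finitely many
    directions [u] control the norm of [f], so finitely many choices [G u]
    suffice, and the small multiple can be absorbed: [f] itself is bounded
    ([bounded_of_lower_bound]).

    The bound is used with [z = x + eps0 *: d], twice.  With [y = x] and
    [p = eps0 *: d] it says that the part of [A x] on which [f d] is at least a
    given constant is bounded.  This part is closed, because maximality
    describes [A x] by weak inequalities, hence compact; so [f d] attains its
    maximum over [A x], and the maximizers form a compact set.

    For the sequence, write [x_ n - x = t_ n *: d_ n] with [d_ n] tending to
    [d].  Monotonicity between [x_ n] and [x] bounds the values of [A (x_ n)]
    below on [d_ n], and [p = eps0 *: d_ n] is close to [z - x_ n]; so these
    values are eventually uniformly bounded
    ([eventually_bounded_along_direction]).  Were the inclusion to fail, values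
    staying [eps]-far from the face would have a convergent subsequence.  Its
    limit lies in [A x] by maximality, and maximizes [f d] because monotonicity,
    divided by [t_ n], reads [g (d_ n) <= f_ n (d_ n)] for every [g] in [A x]
    ([limit_in_directional_face]): the limit is in the face, a contradiction. *)

(** * Pairing and continuity in the dual *)

Lemma dual_norm_bound (R : realType) (X : normedModType R) (f : dual X)
    (u : X) :
  `|f u : R| <= `|f| * `|u|.
Proof.
have fbd : has_sup [set `|f x| | x in [set x | `|x| <= 1]].
  split; first by exists `|f 0|, 0 => //=; rewrite normr0.
  have [k k0 fk] := @linear_lipschitz R X R^o f (@dual_continuous R X f).
  by exists k => _ [x /= x1 <-]; rewrite (le_trans (fk x))// ler_piMr// ltW.
have [->|u0] := eqVneq u 0; first by rewrite linear0 !normr0 mulr0.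
have nu0 : 0 < `|u| by rewrite normr_gt0.
rewrite -ler_pdivrMr// dual_normE; apply: sup_upper_bound => //.
exists (`|u|^-1 *: u) => /=.
  by rewrite normrZ normfV normr_id mulVf// gt_eqF.
by rewrite linearZ/= normrM normfV normr_id mulrC.
Qed.

Lemma dualB (R : realType) (X : normedModType R) (f g : dual X) (u : X) :
  ((f - g) u : R) = (f u : R) - (g u : R).
Proof. by []. Qed.

(** The pairing is jointly continuous: split [f_ t (u_ t)] as
    [(f_ t - f) (u_ t) + f (u_ t)]. *)
Lemma dual_pairing_cvg (R : realType) (X : normedModType R) (T : Type)
    (F : set_system T) {FF : ProperFilter F} (f_ : T -> dual X) (u_ : T -> X)
    (f : dual X) (u : X) :
  f_ t @[t --> F] --> f -> u_ t @[t --> F] --> u ->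
  (f_ t (u_ t) : R) @[t --> F] --> (f u : R).
Proof.
move=> ff uu.
have -> : (fun t => f_ t (u_ t) : R) =
    (fun t => (f_ t - f) (u_ t) + f (u_ t) : R).
  by apply/funext => t; rewrite dualB subrK.
rewrite -[X in _ --> X]add0r; apply: (@cvgD R R).
  apply: norm_cvg0.
  apply: (@squeeze_cvgr _ _ _ _ (cst 0) (fun t => `|f_ t - f| * `|u_ t|)).
  - apply: nearW => t; rewrite normr_ge0/=.
    exact: (dual_norm_bound (f_ t - f) (u_ t)).
  - exact: cvg_cst.
  - rewrite -(mul0r `|u|); apply: cvgM; last exact: cvg_norm.
    by apply/norm_cvg0P; rewrite -(subrr f); apply: cvgB => //; exact: cvg_cst.
exact: (continuous_cvg _ (@dual_continuous R X f u)).
Qed.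

Lemma dual_eval_continuous (R : realType) (X : normedModType R) (u : X) :
  continuous (fun f : dual X => f u : R).
Proof.
move=> f; apply: (@dual_pairing_cvg _ _ _ (nbhs f) _ id (fun=> u)).
  exact: cvg_id.
exact: cvg_cst.
Qed.

Lemma dual_closed_halfspace (R : realType) (X : normedModType R) (u : X)
    (c : R) :
  closed [set f : dual X | c <= (f u : R)].
Proof.
apply: (@preimage_closed _ _ (fun f : dual X => f u : R) [set r | c <= r]).
  by move=> f _; exact: dual_eval_continuous.
exact: closed_ge.
Qed.

(** * Finite-dimensional spaces and their duals *)

Lemma continuous_sumr (R : numFieldType) (T : topologicalType)
    (V : normedModType R) (n : nat) (F : 'I_n -> T -> V) :
  (forall i, continuous (F i)) -> continuous (fun t => \sum_i F i t).
Proof.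
move=> cF t; rewrite (_ : (fun t => _) = \sum_i F i).
  elim/big_rec: _ => [|i g _ cg]; first exact: cst_continuous.
  by apply: (@continuousD _ _ _ (F i) g) => //; exact: cF.
by apply/funext => s; rewrite fct_sumE.
Qed.

Lemma linear_rV_continuous (R : numFieldType) (V : normedModType R) (n : nat)
    (g : {linear 'rV[R]_n -> V}) : continuous g.
Proof.
have -> : (g : 'rV[R]_n -> V) =
    fun c => \sum_i c 0 i *: g (delta_mx 0 i).
  by apply/funext => c; rewrite [in LHS](row_sum_delta c) linear_sum;
    apply: eq_bigr => i _; rewrite linearZ.
apply: continuous_sumr => i c.
by apply: continuousZr_tmp; exact: coord_continuous.
Qed.

Lemma rV_closed_norm_le_compact (R : realType) n (A : set 'rV[R]_n) (K : R) :
  closed A -> (forall c, A c -> `|c| <= K) -> compact A.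
Proof.
move=> cA AK; apply: bounded_closed_compact => //.
exists K; split=> [|M KM c /AK cK]; first exact: num_real.
exact: le_trans cK (ltW KM).
Qed.

(** The norm of [g c] is positive on the unit sphere of ['rV_n], which is
    compact, so it has a positive minimum there; homogeneity does the rest.
    This is what makes the coordinates on a finite-dimensional normed space
    continuous. *)
Lemma linear_rV_lower_bound (R : realType) (X : normedModType R) (n : nat)
    (g : {linear 'rV[R]_n -> X}) :
  injective g -> exists2 m : R, 0 < m & forall c, m * `|c| <= `|g c|.
Proof.
move=> ginj.
pose S : set 'rV[R]_n := [set c | `|c| = 1].
have [S0|S0] := pselect (S !=set0); last first.
  exists 1 => // c; have [->|c0] := eqVneq c 0; first by rewrite normr0 mulr0.
  exfalso; apply: S0; exists (`|c|^-1 *: c).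
  by rewrite /S/= normrZ normfV normr_id mulVf// normr_eq0.
have cS : compact S.
  apply: (@rV_closed_norm_le_compact _ _ _ 1) => [|c ->//].
  apply: (@preimage_closed _ _ (fun c : 'rV[R]_n => `|c|) [set 1 : R]).
    by move=> c _; exact: norm_continuous.
  exact: closed_eq.
have [|c0 + c0min] := @EVT_min_rV R n (fun c => `|g c|) S S0 cS.
  apply: continuous_subspaceT => c; apply: continuous_comp.
    exact: linear_rV_continuous.
  exact: norm_continuous.
rewrite inE => c0S; exists `|g c0|.
  rewrite normr_gt0; apply/eqP; rewrite -(linear0 g) => /ginj c00.
  by move: c0S; rewrite c00 /S/= normr0 => /esym/eqP; rewrite oner_eq0.
move=> c; have [->|cn0] := eqVneq c 0; first by rewrite normr0 mulr0.
have nc : 0 < `|c| by rewrite normr_gt0.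
rewrite -ler_pdivlMr//.
have /c0min : `|c|^-1 *: c \in S.
  by rewrite inE /S/= normrZ normfV normr_id mulVf// gt_eqF.
by rewrite linearZ/= normrZ normfV normr_id mulrC.
Qed.

(** The [phi i] are the coordinates on [X] and the [e i] the vectors of the
    corresponding basis.  This expansion is the only form in which finite
    dimension enters the rest of the proof. *)
Lemma dual_basis (R : realType) (X : normedModType R) :
  finite_dimensional X ->
  exists n (e : 'I_n -> X) (phi : 'I_n -> dual X),
    forall f : dual X, f = \sum_i (f (e i) : R) *: phi i.
Proof.
move=> [n [[v2r lv [r2v v2rK r2vK]]]].
pose lV : {linear X -> 'rV[R]_n} :=
  HB.pack v2r (GRing.isLinear.Build R X 'rV[R]_n *:%R v2r lv).
have lr : linear r2v.
  by move=> a b c; apply: (can_inj v2rK); rewrite lv !r2vK.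
pose lR : {linear 'rV[R]_n -> X} :=
  HB.pack r2v (GRing.isLinear.Build R 'rV[R]_n X *:%R r2v lr).
have [m m0 mP] := @linear_rV_lower_bound R X n lR (can_inj r2vK).
have lphi i : linear (fun x : X => v2r x 0 i : R^o).
  by move=> a u v; rewrite lv !mxE.
have cphi i : continuous (fun x : X => v2r x 0 i : R^o).
  have cv : continuous lV.
    apply: bounded_linear_continuous; apply/linear_boundedP.
    near=> r => x; have := mP (v2r x); rewrite /= v2rK.
    rewrite -ler_pdivlMl// => /le_trans; apply; rewrite ler_wpM2r//.
  move=> x; apply: (@continuous_comp _ _ _ v2r (fun c : 'rV[R]_n => c 0 i)).
    exact: cv.
  exact: coord_continuous.
have phiP i : (fun x : X => v2r x 0 i : R^o) \in continuous_linear X.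
  by rewrite inE; split; [exact: lphi|exact: cphi].
exists n, (fun i => r2v (delta_mx 0 i)), (fun i => Dual (phiP i)) => f.
apply/val_inj/funext => x.
have -> : val (\sum_i (f (r2v (delta_mx 0 i)) : R) *: Dual (phiP i)) x =
    \sum_i ((f (r2v (delta_mx 0 i)) : R) *: Dual (phiP i)) x.
  by elim/big_rec2: _ => //= i y g _ <-.
have xE : x = \sum_i v2r x 0 i *: r2v (delta_mx 0 i).
  transitivity (lR (v2r x)); first by rewrite /= v2rK.
  rewrite [in LHS](row_sum_delta (v2r x)) linear_sum.
  by apply: eq_bigr => i _; rewrite linearZ.
rewrite /= [in LHS]xE linear_sum; apply: eq_bigr => i _.
by rewrite linearZ/= [LHS]mulrC.
Unshelve. all: by end_near. Qed.

(** Heine-Borel in the dual: by [dual_basis], [B] is the image, under a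
    continuous linear map, of a closed bounded set of coordinate vectors. *)
Lemma dual_closed_norm_le_compact (R : realType) (X : normedModType R)
    (B : set (dual X)) (K : R) :
  finite_dimensional X -> closed B -> (forall f, B f -> `|f| <= K) -> compact B.
Proof.
move=> /dual_basis[n [e [phi fE]]] cB BK.
pose psi (c : 'rV[R]_n) : dual X := \sum_i c 0 i *: phi i.
have cpsi : continuous psi.
  apply: continuous_sumr => i c.
  by apply: continuousZr_tmp; exact: coord_continuous.
pose ev (f : dual X) : 'rV[R]_n := \row_i (f (e i) : R).
have evK f : psi (ev f) = f.
  by rewrite [RHS]fE; apply: eq_bigr => i _; rewrite mxE.
pose L := \sum_i `|e i|.
pose C : set 'rV[R]_n := [set c | `|c| <= K * L] `&` psi @^-1` B.
have -> : B = psi @` C.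
  apply/seteqP; split=> [f Bf|_ [c [_ Bc] <-]]; last by [].
  exists (ev f); last exact: evK.
  split; last by rewrite /preimage/= evK.
  have K0 : 0 <= K by exact: le_trans (BK _ Bf).
  rewrite /= [leLHS]mx_normrE; apply: bigmax_le => [|[i j] _ /=].
    by rewrite mulr_ge0// sumr_ge0.
  rewrite mxE (le_trans (dual_norm_bound _ _))// ler_pM//; first exact: BK.
  by rewrite /L (bigD1 j)//= lerDl sumr_ge0.
apply: continuous_compact; first exact: continuous_subspaceT.
apply: (@rV_closed_norm_le_compact _ _ _ (K * L)) => [|c []//].
apply: closedI.
  apply: (@preimage_closed _ _ (fun c : 'rV[R]_n => `|c|) [set x | x <= K * L]).
    by move=> c _; exact: norm_continuous.
  exact: closed_le.
by apply: preimage_closed => // c _; exact: cpsi.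
Qed.

(** A one-sided bound on the finitely many vectors [+/- rho *: e i] controls the
    whole norm of a functional.  No sign is assumed of [C]: opposite vectors
    force it to be nonnegative, except when [s] is empty, and then the
    functional is zero. *)
Lemma finite_norming (R : realType) (X : normedModType R) (r : R) :
  finite_dimensional X -> 0 < r ->
  exists (M : R) (s : seq X), [/\ 0 <= M, forall u, u \in s -> `|u| < r &
    forall (f : dual X) (C : R), (forall u, u \in s -> (f u : R) <= C) ->
      `|f| <= M * C].
Proof.
move=> /dual_basis[n [e [phi fE]]] r0.
(* The leading 1 keeps [L] positive when all [e i] vanish or [n = 0]. *)
pose L := 1 + \sum_i `|e i|.
have L0 : 0 < L by rewrite ltr_wpDr// sumr_ge0.
pose rho := r / (2 * L).
have rho0 : 0 < rho by rewrite divr_gt0// mulr_gt0.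
exists ((\sum_i `|phi i|) / rho),
  ([seq rho *: e i | i <- enum 'I_n] ++ [seq - (rho *: e i) | i <- enum 'I_n]).
have small i : `|rho *: e i| < r.
  rewrite normrZ gtr0_norm// /rho mulrAC ltr_pdivrMr ?mulr_gt0//.
  rewrite ltr_pM2l// (@le_lt_trans _ _ L)//; last by rewrite ltr_pMl// ltr1n.
  by rewrite /L (bigD1 i)//= addrCA lerDl addr_ge0// sumr_ge0.
split=> [|u|f C fC].
- by rewrite divr_ge0 ?sumr_ge0// ltW.
- by rewrite mem_cat => /orP[] /mapP[i _ ->]; rewrite ?normrN; exact: small.
- rewrite [X in `|X|]fE (le_trans (ler_norm_sum _ _ _))//.
  rewrite -mulrA mulr_suml ler_sum// => i _.
  rewrite normrZ mulrC ler_wpM2l// ler_pdivlMl//.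
  have -> : rho * `|f (e i) : R| = `|rho * (f (e i) : R)|.
    by rewrite normrM gtr0_norm.
  rewrite ler_norml.
  have fN : - (rho * (f (e i) : R)) <= C.
    have : (f (- (rho *: e i)) : R) <= C.
      apply: fC; rewrite mem_cat; apply/orP; right; apply/mapP.
      by exists i; rewrite ?mem_enum.
    by rewrite linearN linearZ.
  rewrite lerNl fN/=.
  have : (f (rho *: e i) : R) <= C.
    apply: fC; rewrite mem_cat; apply/orP; left; apply/mapP.
    by exists i; rewrite ?mem_enum.
  by rewrite linearZ.
Qed.

(** A cluster point of the sequence is reached along indices [sigma k >= k]
    chosen within [1 / (k + 1)] of it. *)
Lemma compact_subsequence (R : realType) (V : normedModType R) (B : set V)
    (f_ : nat -> V) :
  compact B -> (forall k, B (f_ k)) ->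
  exists2 f, B f & exists2 sigma : nat -> nat,
    sigma k @[k --> \oo] --> \oo & f_ (sigma k) @[k --> \oo] --> f.
Proof.
move=> cB Bf.
have [|f [Bf' clf]] := cB (f_ @ \oo) _.
  by exists 0%N => // k _; exact: Bf.
exists f => //.
have sub k : exists m, (k <= m)%N /\ `|f - f_ m| < k.+1%:R^-1.
  have [||_ [[m km <-] fm]] :=
    clf (f_ @` [set m | (k <= m)%N]) (ball f k.+1%:R^-1).
  - by exists k => // m km; exists m.
  - by apply: nbhsx_ballx; rewrite invr_gt0.
  - by exists m; split => //; rewrite -ball_normE in fm.
have {sub} /choice[sigma sigmaP] := sub.
exists sigma.
  by apply/cvgnyPge => N; exists N => // k /leq_trans; apply; case: (sigmaP k).
apply/cvgrPdist_lt => e e0.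
have := @cvg_harmonic R; move/cvgr0Pnorm_lt => /(_ e e0).
apply: filterS => k; rewrite (ger0_norm (harmonic_ge0 k)).
by apply: le_lt_trans; apply: ltW; case: (sigmaP k).
Qed.

(** * Values of monotone operators *)

Section operators.
Variables (R : realType) (X : normedModType R).
Implicit Types (A : X -> set (dual X)) (x y z d p : X) (f g : dual X).

Lemma monotone_pairing A x y f g : monotone_operator A -> A x f -> A y g ->
  (g (x - y) : R) <= f (x - y).
Proof.
move=> mA Axf Ayg; rewrite -subr_ge0 -dualB.
exact: (mA (x, f) (y, g)).
Qed.

(** Otherwise adding the point [(x, f)] to the graph would give a proper
    monotone extension. *)
Lemma maximally_monotone_mem A x f : maximally_monotone A ->
  (forall y g, A y g -> (g (x - y) : R) <= f (x - y)) -> A x f.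
Proof.
move=> [mA maxA] fA; apply: contrapT => nAxf.
pose B y := [set g | A y g \/ y = x /\ g = f].
apply: (maxA B) => [[y g] [y' g']|].
  rewrite /gra/= => -[Ayg|[-> ->]] [Ayg'|[-> ->]].
  - exact: (mA (y, g) (y', g')).
  - change (0 <= (g (y - x) : R) - f (y - x)).
    by rewrite -(opprB x y) !linearN/= opprK addrC subr_ge0; exact: fA.
  - change (0 <= (f (x - y') : R) - g' (x - y')).
    by rewrite subr_ge0; exact: fA.
  - by change (0 <= (f (x - x) : R) - f (x - x)); rewrite subrr.
split; first by move=> [y g] /= Ayg; left.
by move=> /(_ (x, f)) /= BA; apply: nAxf; apply: BA; right.
Qed.

(** Lets the rest of the proof compare real values instead of extended-real
    suprema: being in the face is attaining the maximum at [d]. *)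
Lemma directional_faceP A x d f : directional_face A x d f <->
  A x f /\ forall g, A x g -> (g d : R) <= f d.
Proof.
split=> -[Axf]; [move=> fsup|move=> fmax]; split => //.
  move=> g Axg; rewrite -lee_fin fsup; apply: ereal_sup_ubound.
  by exists g.
apply/eqP; rewrite eq_le; apply/andP; split.
  by apply: ereal_sup_ubound; exists f.
by apply: ge_ereal_sup => _ [g Axg <-]; rewrite lee_fin fmax.
Qed.

(** The a priori bound.  The vector [p] replaces [z - y], on which no lower
    bound of [f] is known; the replacement costs at most [del * `|f|],
    and [del] is chosen from the norming constant alone so that this is absorbed
    in the left-hand side.  In particular [del] does not depend on [D] and
    [c]. *)
Lemma bounded_of_lower_bound A z :
  finite_dimensional X -> monotone_operator A -> (dom A)^° z ->
  exists2 del : R, 0 < del & forall D c : R, exists K : R, forall y f p,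
    A y f -> `|z - y| <= D -> `|z - y - p| <= del -> c <= (f p : R) ->
    `|f| <= K.
Proof.
move=> fd mA /nbhs_ballP[r /= r0 zA].
have [M [s [M0 sr sM]]] := @finite_norming R X r fd r0.
(* The choice [G] is total: it takes the value 0 outside the ball. *)
have /choice[G GP] : forall u, exists g, `|u| < r -> A (z + u) g.
  move=> u; have [ur|] := pselect (`|u| < r); last by exists 0.
  have [|g Ag] := zA (z + u); last by exists g.
  by rewrite -ball_normE /ball_/= opprD addNKr normrN.
exists (2 * (M + 1))^-1; first by rewrite invr_gt0 mulr_gt0// ltr_wpDl.
move=> D c; pose C := \sum_(u <- s) `|G u| * (D + r).
exists (2 * (M * (C - c))) => y f p Ayf zyD zyp cfp.
have {}zyD0 : 0 <= D by exact: le_trans zyD.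
(* Since [M / (2 * (M + 1)) <= 1 / 2], the last term is at most half the left
   side. *)
suff: `|f| <= M * (C - c + (2 * (M + 1))^-1 * `|f|).
  have M1 : M * (2 * (M + 1))^-1 <= 2^-1.
    by rewrite ler_pdivrMr ?mulr_gt0// ?ltr_wpDl// mulKf// lerDl.
  have := ler_wpM2r (normr_ge0 f) M1.
  rewrite mulrDr mulrA; lra.
apply: sM => u us; have Au := GP u (sr u us).
have := monotone_pairing mA Au Ayf.
have -> : (f (z + u - y) : R) = f u + f p + f (z - y - p).
  rewrite -!linearD; congr (f _ : R).
  by rewrite [RHS]addrC [u + p]addrC [RHS]addrA subrK [LHS]addrAC.
have GC : (G u (z + u - y) : R) <= C.
  rewrite (le_trans (ler_norm _))// (le_trans (dual_norm_bound _ _))//.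
  rewrite (@le_trans _ _ (`|G u| * (D + r)))//.
    rewrite ler_wpM2l// addrAC (le_trans (ler_normD _ _))// lerD//.
    by rewrite ltW// sr.
  rewrite /C (big_rem u us)/= lerDl sumr_ge0// => v _.
  by rewrite mulr_ge0// addr_ge0// ltW.
have := dual_norm_bound f (z - y - p).
have : `|f| * `|z - y - p| <= (2 * (M + 1))^-1 * `|f|.
  by rewrite mulrC ler_wpM2r.
move=> h1 h2; have := ler_norm (- (f (z - y - p) : R)); rewrite normrN.
lra.
Qed.

Lemma maximally_monotone_closed A x : maximally_monotone A -> closed (A x).
Proof.
move=> maxA.
have -> : A x = \bigcap_(q in gra A)
    [set f | (q.2 (x - q.1) : R) <= f (x - q.1)].
  apply/seteqP; split=> [f Axf [y g] Ayg /=|f Af].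
    exact: (monotone_pairing maxA.1).
  by apply: maximally_monotone_mem => // y g Ayg; exact: (Af (y, g)).
by apply: closed_bigI => q _; exact: dual_closed_halfspace.
Qed.

(** Monotonicity with the interior point [x + eps0 *: d] makes every set
    [A x `&` [set f | c <= f d]] compact.  Taking for [c] the value at [d] of
    one element gives a maximizer; taking for [c] the maximum gives the face. *)
Lemma directional_face_nonempty_compact A x d (eps0 : R) :
  finite_dimensional X -> maximally_monotone A -> dom A x -> 0 < eps0 ->
  (dom A)^° (x + eps0 *: d) ->
  directional_face A x d !=set0 /\ compact (directional_face A x d).
Proof.
move=> fd maxA [f0 Axf0] e0 intz.
have [del del0 bd] := bounded_of_lower_bound fd maxA.1 intz.
have upper_compact c : compact (A x `&` [set f | c <= (f d : R)]).
  have [K KP] := bd `|eps0 *: d| (eps0 * c).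
  apply: (@dual_closed_norm_le_compact _ _ _ K) => // [|f [Axf cf]].
    apply: closedI; first exact: maximally_monotone_closed.
    exact: dual_closed_halfspace.
  apply: (KP x f (eps0 *: d)) => //.
  - by rewrite addrAC subrr add0r.
  - by rewrite (addrAC x) subrr add0r subrr normr0 ltW.
  - by rewrite linearZ/= ler_pM2l.
(* Maximize first above the level of an arbitrary [f0] in [A x], where
   compactness is available; a maximizer there is one over all of [A x]. *)
have [||fm] :=
    @compact_EVT_max _ R (fun f : dual X => f d : R) _ _ (upper_compact (f0 d)).
- by exists f0; split => //=.
- apply: continuous_subspaceT; exact: dual_eval_continuous.
rewrite inE => -[Axfm /= f0m] fmmax.
have fmP g : A x g -> (g d : R) <= fm d.
  move=> Axg; have [f0g|/ltW/le_trans] := leP (f0 d : R) (g d); last exact.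
  by apply: fmmax; rewrite inE.
split; first by exists fm; apply/directional_faceP.
have -> : directional_face A x d = A x `&` [set f | (fm d : R) <= f d].
  apply/seteqP; split=> [f /directional_faceP[Axf fmax]|f [Axf fmf]].
    by split => //=; exact: fmax.
  by apply/directional_faceP; split => // g /fmP/le_trans; apply.
exact: upper_compact.
Qed.

(** * Sequences converging along a direction *)

(** Both conditions on the limit are closed ones: monotonicity against the graph
    passes to the limit as it stands, and against [A x] after division by
    [t_ n]. *)
Lemma limit_in_directional_face A x d (x_ d_ : nat -> X) (t_ : nat -> R)
    (f_ : nat -> dual X) f :
  maximally_monotone A ->
  (forall n, 0 < t_ n) -> (forall n, x_ n - x = t_ n *: d_ n) ->
  (forall n, A (x_ n) (f_ n)) ->
  x_ n @[n --> \oo] --> x -> d_ n @[n --> \oo] --> d ->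
  f_ n @[n --> \oo] --> f ->
  directional_face A x d f.
Proof.
move=> maxA t0 xE Af xx dd ff; apply/directional_faceP; split.
  apply: maximally_monotone_mem => // y g Ayg.
  have xyx : x_ n - y @[n --> \oo] --> x - y.
    by apply: cvgB => //; exact: cvg_cst.
  apply: (ler_cvg_to (dual_pairing_cvg (cvg_cst g) xyx)
    (dual_pairing_cvg ff xyx)).
  by apply: nearW => n; exact: (monotone_pairing maxA.1).
move=> g Axg.
apply: (ler_cvg_to (dual_pairing_cvg (cvg_cst g) dd) (dual_pairing_cvg ff dd)).
apply: nearW => n; have := monotone_pairing maxA.1 (Af n) Axg.
by rewrite xE !linearZ/= ler_pM2l.
Qed.

(** The a priori bound applies with [p = eps0 *: d_ n], since
    [z - x_ n - eps0 *: d_ n] tends to [z - x - eps0 *: d = 0]; the lower bound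
    on [f (d_ n)] comes from monotonicity against a fixed element of [A x]. *)
Lemma eventually_bounded_along_direction A x d (eps0 : R)
    (x_ d_ : nat -> X) (t_ : nat -> R) :
  finite_dimensional X -> maximally_monotone A -> dom A x -> 0 < eps0 ->
  (dom A)^° (x + eps0 *: d) ->
  (forall n, 0 < t_ n) -> (forall n, x_ n - x = t_ n *: d_ n) ->
  x_ n @[n --> \oo] --> x -> d_ n @[n --> \oo] --> d ->
  exists K : R, \forall n \near \oo, forall f, A (x_ n) f -> `|f| <= K.
Proof.
move=> fd maxA [f0 Axf0] e0 intz t0 xE xx dd.
have [del del0 bd] := bounded_of_lower_bound fd maxA.1 intz.
set z := x + eps0 *: d in intz bd *.
have zx : z - x_ n @[n --> \oo] --> z - x by apply: cvgB => //; exact: cvg_cst.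
have zxd : z - x_ n - eps0 *: d_ n @[n --> \oo] --> (0 : X).
  rewrite (_ : 0 = z - x - eps0 *: d); last first.
    by rewrite /z (addrAC x) subrr add0r subrr.
  by apply: cvgB => //; apply: cvgZl_tmp.
have [K KP] := bd (`|z - x| + 1) (- (`|f0| * (eps0 * (`|d| + 1)))).
exists K.
near=> n; move=> f Af; apply: (KP (x_ n) f (eps0 *: d_ n)) => //.
- by near: n; apply: (cvgr_norm_le _ zx); rewrite ltrDl ltr01.
- by near: n; apply: cvgr0_norm_le zxd _ del0.
- apply: (@le_trans _ _ (f0 (eps0 *: d_ n) : R)); last first.
    rewrite !linearZ/= ler_pM2l//.
    have := monotone_pairing maxA.1 Af Axf0.
    by rewrite xE !linearZ/= ler_pM2l.
  rewrite lerNl (le_trans (ler_norm _))// normrN.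
  rewrite (le_trans (dual_norm_bound _ _))// ler_wpM2l// normrZ gtr0_norm//.
  rewrite ler_pM2l//; near: n; apply: (cvgr_norm_le _ dd); rewrite ltrDl ltr01.
Unshelve. all: by end_near. Qed.

End operators.

Theorem theorem4p4 (R : realType) (X : completeNormedModType R)
  (A : X -> set (dual X)) (x d : X) (eps0 : R) :
  finite_dimensional X ->
  maximally_monotone A ->
  dom A x ->
  0 < eps0 ->
  interior (dom A) (x + eps0 *: d) ->
  (directional_face A x d !=set0 /\ compact (directional_face A x d)) /\
  (forall x_ : nat -> X,
    (forall n, dom A (x_ n)) ->
    (forall n, x_ n != x) ->
    x_ n @[n --> \oo] --> x ->
    `|x_ n - x|^-1 *: (x_ n - x) @[n --> \oo] --> d ->
    forall eps : R, 0 < eps ->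
    exists N : nat, forall n : nat, (N <= n)%N ->
      A (x_ n) `<=` [set xs + eps *: b | xs in directional_face A x d
                                       & b in dual_ball X]).
Proof.
move=> fd maxA Ax e0 intz; split.
  exact: directional_face_nonempty_compact e0 intz.
move=> x_ _ xn xx dd eps eps_gt0.
pose t_ n := `|x_ n - x|.
pose d_ n := `|x_ n - x|^-1 *: (x_ n - x).
have t0 n : 0 < t_ n by rewrite normr_gt0 subr_eq0.
have xE n : x_ n - x = t_ n *: d_ n by rewrite scalerA divff ?scale1r// gt_eqF.
have [K [N0 _ KP]] :=
  eventually_bounded_along_direction fd maxA Ax e0 intz t0 xE xx dd.
apply: contrapT => far.
(* Beyond the index [k + N0] the values are bounded by [K]; the offset [k] makes
   the chosen indices tend to infinity. *)
have bad k : exists q : nat * dual X, [/\ (k + N0 <= q.1)%N, A (x_ q.1) q.2 &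
    forall g, directional_face A x d g -> eps < `|q.2 - g|].
  apply: contrapT => nbad; apply: far; exists (k + N0)%N => n kn f Af.
  apply: contrapT => nf; apply: nbad; exists (n, f); split => //= g Fg.
  rewrite ltNge; apply/negP => fg; apply: nf.
  exists g => //; exists (eps^-1 *: (f - g)).
    by rewrite /dual_ball/= normrZ normfV gtr0_norm// ler_pdivrMl// mulr1.
  by rewrite scalerA divff ?gt_eqF// scale1r addrC subrK.
have {bad}[q qP] := choice bad.
pose ball_K : set (dual X) := [set f | `|f| <= K].
have cK : compact ball_K.
  apply: (@dual_closed_norm_le_compact _ _ _ K) => //.
  apply: (@preimage_closed _ _ (fun f : dual X => `|f|) [set r | r <= K]).
    by move=> f _; exact: norm_continuous.
  exact: closed_le.
have [|f _ [sigma sigma_oo ff]] :=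
    compact_subsequence (f_ := fun k => (q k).2) cK.
  move=> k; have [kn Af _] := qP k.
  by apply: KP Af; exact: leq_trans (leq_addl _ _) kn.
have q_oo : (q k).1 @[k --> \oo] --> \oo.
  apply/cvgnyPge => N; exists N => // k /= Nk.
  have [kn _ _] := qP k.
  by rewrite (leq_trans Nk)// (leq_trans (leq_addr N0 k)).
have n_oo : (q (sigma k)).1 @[k --> \oo] --> \oo.
  exact: (cvg_comp _ _ sigma_oo q_oo).
have Ff : directional_face A x d f.
  apply: (limit_in_directional_face (x_ := fun k => x_ (q (sigma k)).1)
    (d_ := fun k => d_ (q (sigma k)).1) (t_ := fun k => t_ (q (sigma k)).1)
    (f_ := fun k => (q (sigma k)).2)) => //.
  - by move=> k; case: (qP (sigma k)).
  - exact: (cvg_comp _ _ n_oo xx).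
  - exact: (cvg_comp _ _ n_oo dd).
have [k _ /(_ k (leqnn k))] := cvgr_distC_lt _ _ ff _ eps_gt0.
by have [_ _ /(_ f Ff)/lt_trans far_f /far_f] := qP (sigma k); rewrite ltxx.
Qed.
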